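(* Let $R$ be a commutative ring with unity, let $n,s\ge 1$, $N=n+s$, and let $$\mathcal{M}=\begin{pmatrix}\mathcal{A}&\mathcal{B}\\\mathcal{C}&\mathcal{D}\end{pmatrix}\in R^{N\times N},\quad \mathcal{A}\in R^{n\times n},\ \mathcal{B}\in R^{n\times s},\ \mathcal{C}\in R^{s\times n},\ \mathcal{D}\in R^{s\times s}.$$ Let $f\in R$, $\mathcal{X}\in R^{N\times N}$, and set $\tilde{\mathcal{M}}=f\mathbf{I}_N-\mathcal{X}\mathcal{M}$. Let $\mathrm{m}(x)\in R[x]$ be a nonzero polynomial with $\mathrm{m}(\tilde{\mathcal{M}})=\mathbf{0}$. Let $\mathcal{K}\in R^{s\times s}$ be the lower right $s\times s$ block of the $N\times N$ matrix $\mathrm{p}(f,\tilde{\mathcal{M}};\mathrm{m})\,\mathcal{X}$. Then $$\left(\mathrm{m}(f)\right)^s\det(\mathcal{A})=\det(\mathcal{M})\det(\mathcal{K}).$$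
   Context: For a polynomial $\mathrm{m}(x)=\sum_{k=0}^{d}m_kx^k\in R[x]$, $f\in R$ and $\mathcal{Z}\in R^{N\times N}$, define $$\mathrm{p}(f,\mathcal{Z};\mathrm{m})=\mathrm{p}(f\mathbf{I}_N,\mathcal{Z};\mathrm{m})=\sum_{k=1}^{d}m_k\sum_{i=1}^{k}f^{\,i-1}\mathcal{Z}^{k-i}\in R^{N\times N}.$$ *)

(* Defs.v *)
From HB Require Import structures.
From mathcomp Require Import all_boot all_order all_algebra.

Set Implicit Arguments.
Unset Strict Implicit.
Unset Printing Implicit Defensive.

Import GRing.Theory.
Local Open Scope ring_scope.

(* With d the degree of m, size m = d + 1 when m != 0, so k runs over 1..d. *)
Definition pmx (R : comNzRingType) (N : nat) (f : R) (Z : 'M[R]_N)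
    (m : {poly R}) : 'M[R]_N :=
  \sum_(1 <= k < size m) m`_k *: \sum_(1 <= i < k.+1) f ^+ (i - 1) *: Z ^+ (k - i).

(* Main.v *)
(** The telescoping identity [p(f, Z; m) (f - Z) = m(f) - m(Z)] at
    [Z = f - X M] gives [Y M = m(f) I] for [Y = p(f, Z; m) X].  Replacing the
    upper block row of [Y] by [(I 0)] then gives
    [(I 0; L K) M = (A B; 0 m(f) I)], and taking determinants concludes;
    no division by [m(f)] or [det M] is involved. *)
Require Import Defs.
From HB Require Import structures.
From mathcomp Require Import all_boot all_order all_algebra.

Set Implicit Arguments.
Unset Strict Implicit.
Unset Printing Implicit Defensive.

Import GRing.Theory.
Local Open Scope ring_scope.

(** The factor [f%:M - Z] turns the [i]-th summand into [g (i+1) - g i] with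
    [g i = f^(i-1) Z^(k+1-i)], so the sum telescopes to [g (k+1) - g 1]. *)
Lemma sum_exprZ_mulB (R : comNzRingType) (N : nat) (f : R) (Z : 'M[R]_N)
    (k : nat) :
  (\sum_(1 <= i < k.+1) f ^+ (i - 1) *: Z ^+ (k - i)) *m (f%:M - Z)
    = (f ^+ k)%:M - Z ^+ k.
Proof.
rewrite mulmx_suml.
rewrite (@telescope_sumr_eq _ 1 k.+1
  (fun i => f ^+ (i - 1) *: Z ^+ (k.+1 - i))) //.
  by rewrite !subn1 /= subSS subnn !expr0 scale1r scalemx1.
move=> i /andP[i_gt0 le_ik]; rewrite mulmxBr mul_mx_scalar scalerA -scalemxAl.
have -> : Z ^+ (k - i) *m Z = Z ^+ (k.+1 - i) by rewrite subSn // exprSr.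
by rewrite -exprS subSS subn1 subn0 prednK.
Qed.

Lemma horner_mx_coef (R : comNzRingType) (N : nat) (Z : 'M[R]_N.+1)
    (m : {poly R}) :
  horner_mx Z m = \sum_(k < size m) m`_k *: Z ^+ k.
Proof.
rewrite -[in LHS](coefK m) poly_def rmorph_sum /=.
by apply: eq_bigr => k _; rewrite horner_mxZ rmorphXn /= horner_mx_X.
Qed.

Lemma pmx_mulB (R : comNzRingType) (N : nat) (f : R) (Z : 'M[R]_N.+1)
    (m : {poly R}) :
  pmx f Z m *m (f%:M - Z) = m.[f]%:M - horner_mx Z m.
Proof.
have -> : pmx f Z m *m (f%:M - Z)
    = \sum_(1 <= k < size m) m`_k *: ((f ^+ k)%:M - Z ^+ k).
  rewrite mulmx_suml; apply: eq_bigr => k _.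
  by rewrite -scalemxAl sum_exprZ_mulB.
(* The term at [k = 0] is a multiple of [f^0 - Z^0 = 0], so the constant coefficient of [m] may be
   included. *)
have -> : \sum_(1 <= k < size m) m`_k *: ((f ^+ k)%:M - Z ^+ k)
    = \sum_(0 <= k < size m) m`_k *: ((f ^+ k)%:M - Z ^+ k).
  case: (size m) => [|d]; first by rewrite !big_geq.
  by rewrite [RHS]big_ltn // !expr0 subrr scaler0 add0r.
rewrite big_mkord horner_mx_coef horner_coef raddf_sum -sumrB.
by apply: eq_bigr => k _; rewrite scalerBr scale_scalar_mx.
Qed.

Lemma det_ulsubmx_left_inverse (R : comNzRingType) (n s : nat) (c : R)
    (Y M : 'M[R]_(n + s)) :
  Y *m M = c%:M -> c ^+ s * \det (ulsubmx M) = \det M * \det (drsubmx Y).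
Proof.
move=> YM; have := YM; rewrite -{1}(submxK Y) -{1}(submxK M) mulmx_block.
rewrite scalar_mx_block => /eq_block_mx[_ _ dlE drE].
(* [dlE] and [drE] state that the lower block row of [Y M] is [(0 cI)]. *)
have : block_mx 1%:M 0 (dlsubmx Y) (drsubmx Y) *m M
    = block_mx (ulsubmx M) (ursubmx M) 0 c%:M.
  rewrite -{1}(submxK M) mulmx_block dlE drE.
  by rewrite !mul1mx !mul0mx !addr0.
move/(congr1 determinant); rewrite det_mulmx det_lblock det1 mul1r det_ublock.
by rewrite det_scalar mulrC => ->; rewrite mulrC.
Qed.

(* The block sizes are n.+1 and s.+1 with n, s arbitrary, i.e. any sizes >= 1.
   A nonzero polynomial exists only over a nonzero ring, hence comNzRingType. *)
Theorem theorem2 (R : comNzRingType) (n s : nat)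
    (A : 'M[R]_n.+1) (B : 'M[R]_(n.+1, s.+1))
    (C : 'M[R]_(s.+1, n.+1)) (D : 'M[R]_s.+1)
    (f : R) (X : 'M[R]_(n.+1 + s.+1)) (m : {poly R}) :
  let M := block_mx A B C D in
  let Mt := f%:M - X *m M in
  m != 0 ->
  horner_mx Mt m = 0 ->
  let K := drsubmx (pmx f Mt m *m X) in
  m.[f] ^+ s.+1 * \det A = \det M * \det K.
Proof.
(* With [A] seen as the upper left block of [M], it remains to find a left multiple of [M] equal to
   [m(f) I]. *)
move=> M Mt _ mMt0 K; rewrite -[A](block_mxKul A B C D).
apply: det_ulsubmx_left_inverse.
have XM : X *m M = f%:M - Mt by rewrite /Mt opprB addrC subrK.
by rewrite -mulmxA XM (pmx_mulB f Mt m) mMt0 subr0.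
Qed.
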